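(* Let $n,s\ge 0$ be integers, let $r,k\in\mathbb{Z}$, and let $\lambda\in\mathbb{C}$ with $\lambda\ne 1$. Then, as polynomials in $x$, $$A_{n}^{(r,k)}(x)=\frac{1}{(1-\lambda)^{s}}\sum_{m=0}^{n}\left\{(-1)^{m}\sum_{l=0}^{n-m}\sum_{a=0}^{s}(-\lambda)^{a}\binom{n}{l}\binom{s}{a}S_{1}(n-l,m)A_{l}^{(r,k)}(s-a)\right\}H_{m}^{(s)}(x|\lambda).$$
   Context: All generating functions are formal power series in $t$. For $k\in\mathbb{Z}$, put $\mathrm{Lif}_k(t)=\sum_{n\ge 0}\frac{t^n}{n!(n+1)^k}$. For $r,k\in\mathbb{Z}$, the polynomials $A_n^{(r,k)}(x)\in\mathbb{C}[x]$ are defined by $$\left(\frac{t}{\log(1+t)}\right)^{r}\frac{\mathrm{Lif}_k(\log(1+t))}{(1+t)^{x}}=\sum_{n\ge 0}A_n^{(r,k)}(x)\frac{t^n}{n!}.$$ For $\lambda\in\mathbb{C}$, $\lambda\neq 1$, the Frobenius-Euler polynomials of order $s$ are defined by $\left(\frac{1-\lambda}{e^t-\lambda}\right)^{s}e^{xt}=\sum_{n\ge 0}H_n^{(s)}(x|\lambda)\frac{t^n}{n!}$. $S_1(n,m)$ is the (signed) Stirling number of the first kind: $x(x-1)\cdots(x-n+1)=\sum_{m=0}^n S_1(n,m)x^m$ (with $S_1(0,0)=1$). The convention $0^0=1$ is used. *)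

(* Defs.v *)
From HB Require Import structures.
From mathcomp Require Import all_boot all_order all_algebra.
From mathcomp Require Import boolp.

Set Implicit Arguments.
Unset Strict Implicit.
Unset Printing Implicit Defensive.

Import GRing.Theory.
Local Open Scope ring_scope.

(* Formal power series are wrapped in a record so that [nat -> R] keeps its
   pointwise ring structure, distinct from the Cauchy product below. *)
Record fps (R : Type) := FPS { fps_coef :> nat -> R }.

HB.instance Definition _ (R : Type) := gen_eqMixin (fps R).
HB.instance Definition _ (R : Type) := gen_choiceMixin (fps R).

Lemma fpsP (R : Type) (f g : fps R) : f =1 g <-> f = g.
Proof.
by split=> [|-> //]; case: f g => [f] [g] /= fg; congr FPS; apply/funext.
Qed.

Section Ring.
Variable R : comNzRingType.
Implicit Types f g h : fps R.

Definition fpsC (c : R) : fps R := FPS (fun n => if n == 0%N then c else 0).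
Definition fps_add f g : fps R := FPS (fun n => f n + g n).
Definition fps_opp f : fps R := FPS (fun n => - f n).
Definition fps_mul f g : fps R :=
  FPS (fun n => \sum_(i < n.+1) f i * g (n - i)%N).

Let trunc n f : {poly R} := \poly_(i < n.+1) f i.

Let fps_mul_trunc f g N n : (n <= N)%N ->
  fps_mul f g n = (trunc N f * trunc N g)`_n.
Proof.
move=> nN; rewrite coefM; apply: eq_bigr => i _.
have iN : (i <= N)%N by apply: leq_trans nN; rewrite -ltnS.
by rewrite !coef_poly !ltnS iN (leq_trans (leq_subr _ _) nN).
Qed.

Let coefM_trunc (p q p' q' : {poly R}) n :
  (forall i, (i <= n)%N -> p`_i = p'`_i) ->
  (forall i, (i <= n)%N -> q`_i = q'`_i) -> (p * q)`_n = (p' * q')`_n.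
Proof.
move=> pp' qq'; rewrite !coefM; apply: eq_bigr => i _.
by rewrite pp' ?qq' ?leq_subr // -ltnS.
Qed.

Let trunc_mul f g n i : (i <= n)%N ->
  (trunc n (fps_mul f g))`_i = (trunc n f * trunc n g)`_i.
Proof. by move=> ni; rewrite coef_poly ltnS ni (fps_mul_trunc _ _ ni). Qed.

Fact fps_addA : associative fps_add.
Proof. by move=> f g h; apply/fpsP => n /=; rewrite addrA. Qed.
Fact fps_addC : commutative fps_add.
Proof. by move=> f g; apply/fpsP => n /=; rewrite addrC. Qed.
Fact fps_add0 : left_id (fpsC 0) fps_add.
Proof. by move=> f; apply/fpsP => n /=; rewrite if_same add0r. Qed.
Fact fps_addN : left_inverse (fpsC 0) fps_opp fps_add.
Proof. by move=> f; apply/fpsP => n /=; rewrite if_same addNr. Qed.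

HB.instance Definition _ := GRing.isZmodule.Build (fps R)
  fps_addA fps_addC fps_add0 fps_addN.

Fact fps_mulC : commutative fps_mul.
Proof.
move=> f g; apply/fpsP => n.
by rewrite !(fps_mul_trunc _ _ (leqnn n)) mulrC.
Qed.
Fact fps_mulA : associative fps_mul.
Proof.
move=> f g h; apply/fpsP => n; rewrite !(fps_mul_trunc _ _ (leqnn n)).
transitivity (trunc n f * (trunc n g * trunc n h))`_n.
  by apply: coefM_trunc => // i /trunc_mul ->.
by rewrite mulrA; apply: coefM_trunc => // i /trunc_mul ->.
Qed.
Fact fps_mul1 : left_id (fpsC 1) fps_mul.
Proof.
move=> f; apply/fpsP => n /=; rewrite big_ord_recl /= mul1r subn0.
by rewrite big1 ?addr0 // => i _; rewrite mul0r.
Qed.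
Fact fps_mulDl : left_distributive fps_mul fps_add.
Proof.
move=> f g h; apply/fpsP => n /=; rewrite -big_split /=.
by apply: eq_bigr => i _; rewrite mulrDl.
Qed.
Fact fps_1neq0 : fpsC 1 != 0.
Proof. by apply/eqP => /fpsP /(_ 0%N) /= /eqP; rewrite oner_eq0. Qed.

HB.instance Definition _ := GRing.Zmodule_isComNzRing.Build (fps R)
  fps_mulA fps_mulC fps_mul1 fps_mulDl fps_1neq0.

(* Substitution f(g(t)); meaningful only when g has no constant term. *)
Definition fps_comp f g : fps R :=
  FPS (fun n => \sum_(i < n.+1) f i * (g ^+ i) n).

Lemma fps_coefM f g n : (f * g) n = \sum_(i < n.+1) f i * g (n - i)%N.
Proof. by []. Qed.

Lemma fps_coefD f g n : (f + g) n = f n + g n.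
Proof. by []. Qed.

Lemma fps_coefN f n : (- f) n = - f n.
Proof. by []. Qed.

Lemma fps_coef1 n : (1 : fps R) n = (n == 0%N)%:R.
Proof. by rewrite /=; case: eqP. Qed.

Lemma fps_coef_sum (I : Type) (r : seq I) (P : pred I) (F : I -> fps R) n :
  (\sum_(i <- r | P i) F i) n = \sum_(i <- r | P i) F i n.
Proof.
by elim/big_rec2: _ => [|i x y _ <- //]; rewrite /= if_same.
Qed.

Lemma fps_exp_low h : h 0%N = 0 -> forall j n, (n < j)%N -> (h ^+ j) n = 0.
Proof.
move=> h0; elim=> // j IH n; rewrite ltnS => nj.
rewrite exprS fps_coefM big_ord_recl h0 mul0r add0r big1 // => i _.
rewrite IH ?mulr0 //= /bump /= add1n.
by apply: leq_trans nj; rewrite subnS prednK ?subn_gt0 ?leq_subr.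
Qed.

Lemma fps_geometric h : h 0%N = 0 ->
  (1 - h) * fps_comp (FPS (fun=> 1)) h = 1.
Proof.
move=> h0; apply/fpsP => n.
transitivity (((1 - h) * \sum_(j < n.+1) h ^+ j) n).
  rewrite !fps_coefM; apply: eq_bigr => i _; congr (_ * _).
  rewrite fps_coef_sum /=.
  under eq_bigr do rewrite mul1r.
  rewrite (big_ord_widen n.+1 (fun j => (h ^+ j) (n - i)%N)) ?ltnS ?leq_subr //.
  rewrite big_mkcond /=; apply: eq_bigr => j _.
  by case: ltnP => // nj; rewrite fps_exp_low.
have -> : (1 - h) * (\sum_(j < n.+1) h ^+ j) = 1 - h ^+ n.+1.
  by rewrite -[1 in RHS](expr1n _ n.+1) subrXX; congr (_ * _);
     apply: eq_bigr => i _; rewrite expr1n mul1r.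
by rewrite fps_coefD fps_coefN fps_exp_low // subr0.
Qed.

End Ring.

Section UnitRing.
Variable R : comUnitRingType.
Implicit Types f g h : fps R.

Definition fps_unit : pred (fps R) := fun f => f 0%N \is a GRing.unit.

(* 1/f = f(0)^-1 / (1 - h) with h = 1 - f(0)^-1 f, expanded geometrically; as
   everywhere in MathComp, a non-unit is its own inverse. *)
Definition fps_inv f : fps R :=
  if fps_unit f then
    fpsC (f 0%N)^-1 * fps_comp (FPS (fun=> 1)) (1 - fpsC (f 0%N)^-1 * f)
  else f.

Fact fps_mulVr : {in fps_unit, left_inverse 1 fps_inv *%R}.
Proof.
move=> f f_unit; have fu : fps_unit f by []; rewrite /fps_inv fu.
rewrite mulrAC -{1}[_ * f](subKr 1) fps_geometric //.
by rewrite fps_coefD fps_coefN fps_coefM big_ord1 /= mulVr // subrr.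
Qed.
Fact fps_unitP f g : g * f = 1 -> fps_unit f.
Proof.
move=> /fpsP /(_ 0%N); rewrite fps_coefM big_ord1 /= => gf.
by apply/unitrP; exists (g 0%N); split; rewrite // mulrC.
Qed.
Fact fps_inv_out : {in [predC fps_unit], fps_inv =1 id}.
Proof. by move=> f /negbTE nfu; rewrite /fps_inv ifF. Qed.

HB.instance Definition _ := GRing.ComNzRing_hasMulInverse.Build (fps R)
  fps_mulVr fps_unitP fps_inv_out.

(* The quotient f(t) / t; meaningful only when f has no constant term. *)
Definition fps_divX f : fps R := FPS (fun n => f n.+1).

(* exp(a t) *)
Definition fps_exp (a : R) : fps R := FPS (fun n => a ^+ n / n`!%:R).

(* log(1 + t) *)
Definition fps_log1p : fps R :=
  FPS (fun n => if n is m.+1 then (-1) ^+ m / m.+1%:R else 0).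

(* t / log(1 + t). As log(1 + t) is not invertible as a power series, this is
   the inverse of log(1 + t) / t, whose constant term is 1. *)
Definition fps_X_div_log1p : fps R := (fps_divX fps_log1p)^-1.

(* (1 + t)^a, as the binomial series *)
Definition fps_binom (a : R) : fps R :=
  FPS (fun n => (\prod_(i < n) (a - i%:R)) / n`!%:R).

Definition Lif (k : int) : fps R :=
  FPS (fun n => (n`!%:R * n.+1%:R ^ k)^-1).

End UnitRing.

(* Signed Stirling numbers of the first kind *)
Definition stirling1 (n m : nat) : int :=
  (\prod_(i < n) ('X - i%:R) : {poly int})`_m.

(* The generating functions below are power series in t over F[x], with 'X
   standing for x. *)
Section Polynomials.
Variable F : fieldType.

Definition polyA_gf (r k : int) : fps {poly F} :=
  fps_X_div_log1p _ ^ r * fps_comp (Lif _ k) (fps_log1p _) / fps_binom 'X.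

Definition polyA (r k : int) (n : nat) : {poly F} :=
  n`!%:R * polyA_gf r k n.

Definition frobenius_euler_gf (s : nat) (lambda : F) : fps {poly F} :=
  (fpsC (1 - lambda)%:P / (fps_exp 1 - fpsC lambda%:P)) ^+ s * fps_exp 'X.

Definition frobenius_euler (s : nat) (lambda : F) (n : nat) : {poly F} :=
  n`!%:R * frobenius_euler_gf s lambda n.

End Polynomials.

Arguments polyA_gf {F} r k.
Arguments polyA {F} r k n.

(* Main.v *)
(* Put u = - log(1 + t). Then (1 + t)^(-x) = exp(x u), and the coefficient of
   t^n / n! in log(1 + t)^m / m! is S_1(n, m). Substituting u into
     (1 - lambda)^s exp(x t) = (exp t - lambda)^s * sum_m H_m t^m / m!
   and multiplying by (t / log(1 + t))^r Lif_k(log(1 + t)) yields the theorem: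
   the binomial expansion of (exp u - lambda)^s turns the right factor into the
   generating functions of the A_l(s - a). *)
From HB Require Import structures.
Require Import Defs.
From mathcomp Require Import all_boot all_order all_algebra.
From mathcomp Require Import ring reals.
From mathcomp.real_closed Require Import complex.

Import GRing.Theory.
Local Open Scope ring_scope.

(** * Constants, substitution and the derivation on formal power series *)

Section Composition.
Context {R : comNzRingType}.
Implicit Types f g h : fps R.

Fact fpsC_is_zmod_morphism : zmod_morphism (@fpsC R).
Proof.
by move=> a b; apply/fpsP => -[|n] //=; rewrite oppr0 addr0.
Qed.

Fact fpsC_is_monoid_morphism : monoid_morphism (@fpsC R).
Proof.
split=> // a b; apply/fpsP => n; rewrite fps_coefM big_ord_recl /= subn0.
by rewrite big1 => [|i _]; rewrite ?mul0r // addr0; case: n => //=; rewrite mulr0.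
Qed.

HB.instance Definition _ := GRing.isZmodMorphism.Build R (fps R) (@fpsC R)
  fpsC_is_zmod_morphism.
HB.instance Definition _ := GRing.isMonoidMorphism.Build R (fps R) (@fpsC R)
  fpsC_is_monoid_morphism.

Lemma fps_coefCM (c : R) f n : (fpsC c * f) n = c * f n.
Proof.
rewrite fps_coefM big_ord_recl subn0 big1 ?addr0 // => i _.
by rewrite mul0r.
Qed.

Lemma fps_coefMn f m n : (f *+ m) n = f n *+ m.
Proof.
elim: m => [|m IH]; first by rewrite !mulr0n /= if_same.
by rewrite !mulrS fps_coefD IH.
Qed.

Lemma fps_compE f g N n : g 0%N = 0 -> (n <= N)%N ->
  fps_comp f g n = \sum_(i < N.+1) f i * (g ^+ i) n.
Proof.
move=> g0 nN; rewrite /= (big_ord_widen N.+1 (fun i => f i * (g ^+ i) n)) //.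
rewrite big_mkcond /=; apply: eq_bigr => i _.
by case: ltnP => // ni; rewrite fps_exp_low ?mulr0.
Qed.

Let trunc N f : {poly R} := \poly_(i < N.+1) f i.
(** Unlike substitution, this evaluation is known to be multiplicative in [p]; substitution inherits
    the property through truncations of [f]. *)
Let ev g (p : {poly R}) : fps R := (map_poly (@fpsC R) p).[g].

Let ev_coef g (p : {poly R}) N n : (size p <= N)%N ->
  ev g p n = \sum_(i < N) p`_i * (g ^+ i) n.
Proof.
move=> pN; rewrite /ev (@horner_coef_wide _ N); last first.
  by rewrite (leq_trans (size_poly _ _)).
by rewrite fps_coef_sum; apply: eq_bigr => i _; rewrite coef_map fps_coefCM.
Qed.

Let comp_ev f g N n : g 0%N = 0 -> (n <= N)%N ->
  fps_comp f g n = ev g (trunc N f) n.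
Proof.
move=> g0 nN; rewrite (fps_compE f _ _ _ g0 nN) (ev_coef _ _ N.+1) ?size_poly //.
by apply: eq_bigr => i _; rewrite coef_poly ltn_ord.
Qed.

Lemma fps_compM f g h : h 0%N = 0 ->
  fps_comp (f * g) h = fps_comp f h * fps_comp g h.
Proof.
move=> h0; apply/fpsP => n.
transitivity (ev h (trunc n f * trunc n g) n).
  (* [p] agrees with [f * g] up to degree [n] but may reach further. [N] covers all its terms, and
     those of index above [n] vanish because [h ^+ i] has order at least [i]. *)
  set p : {poly R} := trunc n f * trunc n g; pose N := maxn (size p) n.
  rewrite (fps_compE _ _ N) ?leq_maxr // (ev_coef _ _ N.+1); last first.
    by rewrite ltnW // ltnS leq_maxl.
  apply: eq_bigr => i _; case: (leqP i n) => [i_n|ni]; last first.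
    by rewrite (@fps_exp_low _ h h0) ?mulr0.
  congr (_ * _); rewrite /p coefM fps_coefM; apply: eq_bigr => j _.
  have jn : (j <= n)%N by apply: leq_trans i_n; rewrite -ltnS.
  by rewrite !coef_poly !ltnS jn (leq_trans (leq_subr _ _) i_n).
rewrite /ev rmorphM hornerM !fps_coefM; apply: eq_bigr => i _.
by congr (_ * _); symmetry; apply: comp_ev; rewrite ?leq_subr // -ltnS.
Qed.

Lemma fps_compB f g h : fps_comp (f - g) h = fps_comp f h - fps_comp g h.
Proof.
apply/fpsP => n; rewrite fps_coefD fps_coefN /= -sumrB.
by apply: eq_bigr => i _; rewrite mulrBl.
Qed.

Lemma fps_compC (c : R) h : fps_comp (fpsC c) h = fpsC c.
Proof.
apply/fpsP => n; rewrite /= big_ord_recl big1 => [|i _]; last by rewrite mul0r.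
by rewrite addr0 expr0 fps_coef1 /=; case: eqP; rewrite ?mulr1 ?mulr0.
Qed.

Lemma fps_compX f h m : h 0%N = 0 ->
  fps_comp (f ^+ m) h = fps_comp f h ^+ m.
Proof.
move=> h0; elim: m => [|m IH]; first exact: fps_compC.
by rewrite !exprS fps_compM // IH.
Qed.

(* The derivation t d/dt, for which the Leibniz rule is a coefficientwise
   identity. *)
Definition fps_theta f : fps R := FPS (fun n => f n *+ n).

Lemma fps_thetaM f g :
  fps_theta (f * g) = fps_theta f * g + f * fps_theta g.
Proof.
apply/fpsP => n; rewrite fps_coefD !fps_coefM /= -big_split /= -sumrMnl.
apply: eq_bigr => i _.
by rewrite mulrnAl mulrnAr -mulrnDr subnKC // -ltnS.
Qed.

Lemma fps_thetaX f m : fps_theta (f ^+ m.+1) = f ^+ m * fps_theta f *+ m.+1.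
Proof.
elim: m => [|m IH]; first by rewrite mul1r.
rewrite exprS fps_thetaM IH mulrnAr mulrA -exprS [in RHS]mulrS.
by rewrite mulrC.
Qed.

Definition fps_X : fps R := FPS (fun n => (n == 1%N)%:R).

Lemma fps_coefXM f n : (fps_X * f) n.+1 = f n.
Proof.
rewrite fps_coefM big_ord_recl mul0r add0r big_ord_recl mul1r subSS subn0.
by rewrite big1 ?addr0 // => i _; rewrite mul0r.
Qed.

End Composition.

(** * Stirling numbers of the first kind *)

Lemma stirling1_0n n : stirling1 n.+1 0 = 0.
Proof.
by rewrite /stirling1 big_ord_recl coef0M coefB coefX coefC subr0 mul0r.
Qed.

Lemma stirling1S n m :
  stirling1 n.+1 m.+1 = stirling1 n m - n%:R * stirling1 n m.+1.
Proof.
rewrite /stirling1 big_ord_recr /= mulrBr coefB coefMX.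
by rewrite -polyC_natr coefMC mulrC.
Qed.

Lemma size_stirling1_poly n :
  size (\prod_(i < n) ('X - i%:R) : {poly int}) = n.+1.
Proof.
under eq_bigr do rewrite -polyC_natr.
by rewrite size_prod_XsubC [index_enum _]unlock -enumT size_enum_ord.
Qed.

Lemma stirling1_small n m : (n < m)%N -> stirling1 n m = 0.
Proof.
move=> nm; apply: nth_default; apply: leq_trans nm.
by rewrite size_stirling1_poly.
Qed.

(** * Exponential, logarithm and binomial series *)

Section RationalAlgebra.
Context {R : comUnitRingType}.
(** Inverting only the positive integers, rather than asking for a field, lets [{poly F}] serve as
    coefficient ring. *)
Hypothesis natr_unit : forall n, n.+1%:R \is a @GRing.unit R.
Implicit Types a b : R.

Lemma fact_unit n : n`!%:R \is a @GRing.unit R.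
Proof. by case: n`! (fact_gt0 n). Qed.

Lemma fps_unitE (f : fps R) : (f \is a GRing.unit) = (f 0%N \is a GRing.unit).
Proof. by []. Qed.

Lemma fps_expD a b : fps_exp (a + b) = fps_exp a * fps_exp b.
Proof.
apply/fpsP => n; rewrite fps_coefM /= addrC exprDn mulr_suml.
apply: eq_bigr => i _; have i_n : (i <= n)%N by rewrite -ltnS.
have binV : 'C(n, i)%:R / n`!%:R = i`!%:R^-1 / (n - i)`!%:R :> R.
  apply: (mulIr (fact_unit n)); rewrite divrK ?fact_unit // -(bin_fact i_n).
  by rewrite !natrM mulrCA mulrACA !mulVr ?fact_unit // !mulr1.
by rewrite -mulr_natr -!mulrA binV; ring.
Qed.

Lemma fps_expMn j : fps_exp (j%:R : R) = fps_exp 1 ^+ j.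
Proof.
elim: j => [|j IH]; last by rewrite exprS -IH -fps_expD -natr1 addrC.
apply/fpsP => n; rewrite expr0 fps_coef1 /= expr0n.
by case: n => [|n]; rewrite ?mul0r // divr1.
Qed.

(** The coefficients of t d/dt log(1 + t) are alternating signs, which cancel in consecutive pairs
    after multiplication by 1 + t. *)
Lemma fps_theta_log1p : (1 + fps_X) * fps_theta (fps_log1p R) = fps_X.
Proof.
have theta_coef n : fps_theta (fps_log1p R) n.+1 = (-1) ^+ n.
  by rewrite /= -[LHS]mulr_natr divrK.
apply/fpsP => -[|n]; first by rewrite fps_coefM big_ord1 /= mulr0n mulr0.
rewrite mulrDl mul1r fps_coefD fps_coefXM theta_coef.
case: n => [|n]; first by rewrite /= mulr0n addr0.
by rewrite theta_coef exprS mulN1r addNr.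
Qed.

(** Induction on [n]: with L = log(1 + t), applying t d/dt to L^(m+1) and clearing 1 + t gives (m+1)
    t L^m. Comparing coefficients of t^(n+1) reproduces the recurrence [stirling1S]. *)
Lemma log1p_exp_coef m n :
  (fps_log1p R ^+ m) n * n`!%:R = (stirling1 n m)%:~R * m`!%:R.
Proof.
elim: n m => [|n IH] [|m].
- by rewrite fps_coef1 /stirling1 big_ord0 coef1 !mulr1.
- by rewrite fps_exp_low // stirling1_small // !mul0r.
- by rewrite fps_coef1 stirling1_0n !mul0r.
have: (1 + fps_X) * fps_theta (fps_log1p R ^+ m.+1)
      = fps_X * (fps_log1p R ^+ m *+ m.+1).
  by rewrite fps_thetaX mulrnAr mulrCA fps_theta_log1p mulrC mulrnAr.
move=> /fpsP /(_ n.+1); rewrite mulrDl mul1r fps_coefD !fps_coefXM /=.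
rewrite fps_coefMn => rec.
set l := fps_log1p R ^+ m.+1 in rec *.
have -> : l n.+1 * (n.+1)`!%:R = (l n.+1 *+ n.+1) * n`!%:R.
  by rewrite factS natrM mulrA [l _ * _]mulr_natr.
(* [rec] trades the coefficient of index [n.+1] for coefficients of index [n], to which [IH] applies
   with exponents [m] and [m.+1]. *)
rewrite -[l n.+1 *+ _](addrK (l n *+ n)) rec stirling1S.
rewrite mulrBl -[l n *+ n]mulr_natr -[_ *+ m.+1]mulr_natr 2!(mulrAC _ _ n`!%:R).
rewrite !IH rmorphB rmorphM /= rmorph_nat mulrBl factS natrM; ring.
Qed.

Lemma falling_stirling1 a n :
  \prod_(i < n) (a - i%:R) = \sum_(m < n.+1) (stirling1 n m)%:~R * a ^+ m.
Proof.
transitivity (map_poly intr (\prod_(i < n) ('X - i%:R) : {poly int})).[a].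
  rewrite rmorph_prod horner_prod; apply: eq_bigr => i _ /=.
  by rewrite rmorphB /= map_polyX rmorph_nat -polyC_natr hornerXsubC.
rewrite (@horner_coef_wide _ n.+1); last first.
  by rewrite -[X in (_ <= X)%N]size_stirling1_poly size_poly.
by apply: eq_bigr => m _; rewrite coef_map.
Qed.

(** The bound [N] is free so that coefficients of different index [n] can share one range of
    summation, as the final exchange of sums requires. *)
Lemma fps_compNlog1p_coef (f : fps R) N n : (n <= N)%N ->
  n`!%:R * fps_comp f (- fps_log1p R) n =
  \sum_(m < N.+1) (stirling1 n m)%:~R * (-1) ^+ m * (m`!%:R * f m).
Proof.
move=> nN; rewrite (fps_compE _ _ N) //; last by rewrite fps_coefN oppr0.
rewrite mulr_sumr; apply: eq_bigr => m _; rewrite (exprNn (fps_log1p R)).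
have -> : (-1 : fps R) ^+ m = fpsC ((-1) ^+ m) by rewrite rmorphXn rmorphN1.
by rewrite fps_coefCM mulrC -!mulrA log1p_exp_coef; ring.
Qed.

(** Both sides have n-th coefficient, times n!, equal to the falling factorial of [- a], expanded in
    Stirling numbers. *)
Lemma fps_binomN a :
  fps_binom (- a) = fps_comp (fps_exp a) (- fps_log1p R).
Proof.
apply/fpsP => n; apply: (mulrI (fact_unit n)).
rewrite (fps_compNlog1p_coef _ n) //= mulrC divrK ?fact_unit //.
rewrite falling_stirling1; apply: eq_bigr => m _.
by rewrite [m`!%:R * _]mulrC divrK ?fact_unit // (exprNn a) mulrA.
Qed.

Lemma fps_binom_unit a : fps_binom a \is a GRing.unit.
Proof. by rewrite fps_unitE /= big_ord0 divr1 unitr1. Qed.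

Lemma fps_binomV a : (fps_binom a)^-1 = fps_binom (- a).
Proof.
have u0 : (- fps_log1p R) 0%N = 0 by rewrite fps_coefN oppr0.
apply: (mulrI (fps_binom_unit a)); rewrite divrr ?fps_binom_unit //.
rewrite -[X in fps_binom X * _]opprK !fps_binomN -fps_compM // -fps_expD.
(* The exponents cancel, and exp(0) is read as the zeroth power of exp(t). *)
by rewrite addNr (fps_expMn 0) expr0 fps_compC.
Qed.

Lemma fps_divX_log1p_unit : fps_divX (fps_log1p R) \is a GRing.unit.
Proof. by rewrite fps_unitE /= divr1 unitr1. Qed.

End RationalAlgebra.

(** * Change of coefficient ring *)

Section Map.
Context {R S : comNzRingType} (phi : {rmorphism R -> S}).

Definition fps_map (f : fps R) : fps S := FPS (fun n => phi (f n)).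

Fact fps_map_is_zmod_morphism : zmod_morphism fps_map.
Proof. by move=> f g; apply/fpsP => n /=; rewrite rmorphB. Qed.

Fact fps_map_is_monoid_morphism : monoid_morphism fps_map.
Proof.
split=> [|f g]; apply/fpsP => n /=.
  by case: eqP; rewrite ?rmorph1 ?rmorph0.
by rewrite rmorph_sum; apply: eq_bigr => i _; rewrite rmorphM.
Qed.

HB.instance Definition _ := GRing.isZmodMorphism.Build (fps R) (fps S) fps_map
  fps_map_is_zmod_morphism.
HB.instance Definition _ := GRing.isMonoidMorphism.Build (fps R) (fps S) fps_map
  fps_map_is_monoid_morphism.

Lemma fps_map_comp f g : fps_map (fps_comp f g) = fps_comp (fps_map f) (fps_map g).
Proof.
apply/fpsP => n /=; rewrite rmorph_sum; apply: eq_bigr => i _.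
by rewrite rmorphM -rmorphXn.
Qed.

End Map.

Section MapSpecial.
Context {R S : comUnitRingType} (phi : {rmorphism R -> S}).
Hypothesis natr_unit : forall n, n.+1%:R \is a @GRing.unit R.

Lemma fps_map_log1p : fps_map phi (fps_log1p R) = fps_log1p S.
Proof.
apply/fpsP => -[|n] /=; first by rewrite rmorph0.
by rewrite rmorphM rmorphV // rmorph_nat rmorph_sign.
Qed.

Lemma fps_map_X_div_log1p :
  fps_map phi (fps_X_div_log1p R) = fps_X_div_log1p S.
Proof.
rewrite /fps_X_div_log1p rmorphV ?fps_divX_log1p_unit //; congr (_^-1).
by apply/fpsP => n; have /fpsP/(_ n.+1) := fps_map_log1p.
Qed.

Lemma fps_map_Lif k : fps_map phi (Lif R k) = Lif S k.
Proof.
apply/fpsP => n /=; rewrite rmorphV ?rmorphM ?rmorphXz ?rmorph_nat //.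
by rewrite unitrM fact_unit // unitrXz.
Qed.

Lemma fps_map_binom a : fps_map phi (fps_binom a) = fps_binom (phi a).
Proof.
apply/fpsP => n /=; rewrite rmorphM rmorphV ?fact_unit // rmorph_nat rmorph_prod.
by congr (_ / _); apply: eq_bigr => i _; rewrite rmorphB rmorph_nat.
Qed.

(** The variable x becomes an argument: ['X] recovers [polyA_gf], and the constants [(s - a)%:R]
    give the values A_l(s - a). *)
Definition polyA_gf_at (T : comUnitRingType) (r k : int) (a : T) : fps T :=
  fps_X_div_log1p T ^ r * fps_comp (Lif T k) (fps_log1p T) / fps_binom a.

Lemma fps_map_polyA_gf_at r k a :
  fps_map phi (polyA_gf_at R r k a) = polyA_gf_at S r k (phi a).
Proof.
have mapM (f g : fps R) : fps_map phi (f * g) = fps_map phi f * fps_map phi g.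
  exact: rmorphM.
rewrite /polyA_gf_at !mapM.
have -> : fps_map phi (fps_X_div_log1p R ^ r) = fps_X_div_log1p S ^ r.
  rewrite -fps_map_X_div_log1p; apply: rmorphXz.
  by rewrite /fps_X_div_log1p unitrV fps_divX_log1p_unit.
have -> : fps_map phi (fps_binom a)^-1 = (fps_binom (phi a))^-1.
  by rewrite -fps_map_binom; apply: rmorphV; apply: fps_binom_unit.
by rewrite fps_map_comp fps_map_Lif fps_map_log1p.
Qed.

End MapSpecial.

(** * Expansion of A_n in Frobenius-Euler polynomials *)

Section PolyA.
Context {F : fieldType}.
Hypothesis natr_neq0 : forall n, n.+1%:R != 0 :> F.

Lemma poly_natr_unit n : n.+1%:R \is a @GRing.unit {poly F}.
Proof. by rewrite -polyC_natr rmorph_unit ?unitfE ?natr_neq0. Qed.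

Let natr_unit := poly_natr_unit.

(** Evaluation at [c] is taken as the endomorphism [comp_poly c%:P] of [{poly F}], so that all
    series keep the same coefficient ring; it is applied to the generating function
    coefficientwise. *)
Lemma horner_polyA r k (c : F) n :
  (polyA r k n).[c]%:P = n`!%:R * polyA_gf_at {poly F} r k c%:P n.
Proof.
rewrite -comp_polyCr -[X in polyA_gf_at _ _ _ X](comp_polyX c%:P).
rewrite -(fps_map_polyA_gf_at (comp_poly c%:P)) //.
by rewrite /polyA rmorphM rmorph_nat.
Qed.

(** The denominator can be cleared because exp(t) - lambda has the invertible constant term 1 -
    lambda. *)
Lemma frobenius_euler_gfM s (lambda : F) : lambda != 1 ->
  frobenius_euler_gf s lambda * (fps_exp 1 - fpsC lambda%:P) ^+ s =
  fpsC ((1 - lambda) ^+ s)%:P * fps_exp 'X.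
Proof.
move=> lambda_neq1; rewrite /frobenius_euler_gf exprMn exprVn mulrAC.
rewrite divrK; first by rewrite !rmorphXn.
rewrite unitrX // fps_unitE /= expr1n divr1 -polyCB rmorph_unit //.
by rewrite unitfE subr_eq0 eq_sym.
Qed.

Lemma polyA_gf_frobenius_euler s r k (lambda : F) : lambda != 1 ->
  fpsC ((1 - lambda) ^+ s)%:P * polyA_gf r k =
  (\sum_(a < s.+1) fpsC ((- lambda) ^+ a * 'C(s, a)%:R)%:P *
     polyA_gf_at {poly F} r k (s - a)%:R) *
  fps_comp (frobenius_euler_gf s lambda) (- fps_log1p {poly F}).
Proof.
move=> lambda_neq1.
set u := - fps_log1p {poly F}.
have u0 : u 0%N = 0 by rewrite /u fps_coefN oppr0.
(* [G] is the factor free of x, shared by the generating functions at ['X] and at every s - a. *)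
pose G := fps_X_div_log1p {poly F} ^ r * fps_comp (Lif _ k) (fps_log1p {poly F}).
have gfE a : polyA_gf_at {poly F} r k a = G * fps_comp (fps_exp a) u.
  by rewrite /polyA_gf_at fps_binomV // fps_binomN.
have -> : polyA_gf r k = polyA_gf_at {poly F} r k 'X by [].
rewrite gfE mulrCA -{1}(fps_compC _ u) -fps_compM // -frobenius_euler_gfM //.
rewrite fps_compM // fps_compX // fps_compB fps_compC mulrCA mulrC.
congr (_ * _); rewrite exprDn !mulr_sumr; apply: eq_bigr => a _.
rewrite gfE fps_expMn // fps_compX //.
have -> : fpsC ((- lambda) ^+ a * 'C(s, a)%:R)%:P =
    (- fpsC lambda%:P) ^+ a *+ 'C(s, a).
  by rewrite -[RHS]mulr_natr !rmorphM !rmorphXn !rmorphN !rmorph_nat.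
by rewrite mulrnAl mulrnAr; congr (_ *+ _); rewrite mulrA mulrC.
Qed.

Lemma polyA_frobenius_euler s r k (lambda : F) n : lambda != 1 ->
  (1 - lambda) ^+ s *: polyA r k n =
  \sum_(m < n.+1)
    ((-1) ^+ m *
     \sum_(l < (n - m).+1) \sum_(a < s.+1)
       (- lambda) ^+ a * 'C(n, l)%:R * 'C(s, a)%:R *
       (stirling1 (n - l) m)%:~R * (polyA r k l).[(s - a)%:R])
    *: frobenius_euler s lambda m.
Proof.
move=> lambda_neq1.
transitivity (n`!%:R * (fpsC ((1 - lambda) ^+ s)%:P * polyA_gf r k) n).
  by rewrite fps_coefCM /polyA -mul_polyC mulrCA.
rewrite polyA_gf_frobenius_euler // fps_coefM mulr_sumr.
pose term m l a : F := (- lambda) ^+ a * 'C(n, l)%:R * 'C(s, a)%:R *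
  (stirling1 (n - l) m)%:~R * (polyA r k l).[(s - a)%:R].
(* [l] is the Cauchy product index; [m] first runs up to [n] independently of [l], so that the two
   sums can be exchanged. *)
transitivity (\sum_(l < n.+1) \sum_(m < n.+1)
    ((-1) ^+ m * \sum_(a < s.+1) term m l a) *: frobenius_euler s lambda m).
  apply: eq_bigr => l _; have l_n : (l <= n)%N by rewrite -ltnS.
  (* Splitting n! as C(n, l) l! (n - l)! gives each factor of the Cauchy product its own
     factorial. *)
  have facM (x y : {poly F}) : n`!%:R * (x * y) =
      'C(n, l)%:R * (l`!%:R * x) * ((n - l)`!%:R * y).
    by rewrite -(bin_fact l_n) !natrM; ring.
  rewrite facM (fps_compNlog1p_coef _ _ n) ?leq_subr // mulr_sumr.
  apply: eq_bigr => m _; rewrite -/(frobenius_euler s lambda m) -mul_polyC [LHS]mulrA.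
  congr (_ * _); rewrite rmorphM rmorph_sum fps_coef_sum !(mulr_sumr, mulr_suml).
  apply: eq_bigr => a _; rewrite fps_coefCM [l`!%:R * _]mulrCA.
  rewrite -(polyC_natr _ (s - a)) -horner_polyA.
  rewrite /term !rmorphM !rmorphXn !rmorphN !rmorph_nat rmorph_int; ring.
rewrite exchange_big /=; apply: eq_bigr => m _; rewrite -scaler_suml -mulr_sumr.
congr (_ * _ *: _).
(* The range of [l] shrinks to l <= n - m: beyond it n - l < m, so S_1(n - l, m) = 0. *)
rewrite [RHS](big_ord_widen n.+1 (fun l => \sum_(a < s.+1) term m l a)); last first.
  by rewrite ltnS leq_subr.
rewrite [RHS]big_mkcond; apply: eq_bigr => l _ /=; case: ltnP => // nm_l.
apply: big1 => a _; rewrite /term stirling1_small ?mulr0 ?mul0r //.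
by move: nm_l; rewrite !ltn_subLR 1?addnC // -ltnS.
Qed.

End PolyA.

Theorem theorem2p7 (R : realType) (n s : nat) (r k : int) (lambda : R[i])
    (lambda_neq1 : lambda != 1) :
  polyA r k n =
  ((1 - lambda) ^+ s)^-1 *:
    \sum_(m < n.+1)
      ((-1) ^+ m *
       \sum_(l < (n - m).+1) \sum_(a < s.+1)
         (- lambda) ^+ a * 'C(n, l)%:R * 'C(s, a)%:R *
         (stirling1 (n - l) m)%:~R * (polyA r k l).[(s - a)%:R])
      *: frobenius_euler s lambda m
  :> {poly R[i]}.
Proof.
rewrite -polyA_frobenius_euler //; last by move=> j; rewrite Num.Theory.pnatr_eq0.
by rewrite scalerK // expf_neq0 // subr_eq0 eq_sym.
Qed.
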